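(* Let $(X,T)$ be a minimal PI system and $d\ge 2$. Then every $M$-subsystem of $(X^d,\tau_d)$ is minimal, where $\tau_d=T\times T^2\times\cdots\times T^d$.
   Context: A topological dynamical system (t.d.s.) is $(X,T)$ with $X$ compact metric (metric $\rho$) and $T$ a homeomorphism. A subsystem $(Z,\tau_d)$ is a closed $\tau_d$-invariant subset; it is an $M$-system if it is transitive (has a dense orbit) and its minimal points are dense. For a factor map $\pi:(X,T)\to(Y,T)$ let $R_\pi=\{(x_1,x_2):\pi(x_1)=\pi(x_2)\}$. A pair $(x,y)$ is proximal if $\liminf_{n}\rho(T^nx,T^ny)=0$; $\pi$ is proximal if every pair in $R_\pi$ is proximal; $\pi$ is equicontinuous if for every $\epsilon>0$ there is $\delta>0$ such that $(x,y)\in R_\pi$, $\rho(x,y)<\delta$ imply $\rho(T^nx,T^ny)<\epsilon$ for all $n\in\mathbb Z$. A minimal system $X$ is strictly PI if there are an ordinal $\eta$ and systems $\{W_\iota\}_{\iota\le\eta}$ with $W_0$ trivial, $W_\eta=X$, for each $\iota<\eta$ a factor map $W_{\iota+1}\to W_\iota$ which is proximal or equicontinuous, and for limit $\nu\le\eta$, $W_\nu$ the inverse limit of $\{W_\iota\}_{\iota<\nu}$. A minimal system $X$ is PI if there is a strictly PI system $\tilde X$ and a proximal extension $\tilde X\to X$. *)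

(* Defs.v *)
From Stdlib Require Import Reals ZArith List.
From mathcomp Require fintype.
Open Scope R_scope.

(* [B x e y] means "y lies in the open ball of radius e around x". *)
Section Generic.
Context {A : Type} (B : A -> R -> A -> Prop).

Definition closure (S : A -> Prop) (x : A) : Prop :=
  forall e, 0 < e -> exists y, S y /\ B x e y.

Definition closedS (S : A -> Prop) : Prop :=
  forall x, closure S x -> S x.

Definition openS (U : A -> Prop) : Prop :=
  forall x, U x -> exists e, 0 < e /\ forall y, B x e y -> U y.

Definition compact_space : Prop :=
  forall (I : Type) (U : I -> A -> Prop),
    (forall i, openS (U i)) -> (forall x, exists i, U i x) ->
    exists l : list I, forall x, exists i, In i l /\ U i x.

Context (f finv : A -> A).

Definition zpow (n : Z) (x : A) : A :=
  match n with
  | Z0 => x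
  | Zpos p => Nat.iter (Pos.to_nat p) f x
  | Zneg p => Nat.iter (Pos.to_nat p) finv x
  end.

Definition orbit (x : A) : A -> Prop := fun y => exists n : Z, y = zpow n x.

Definition invariant (S : A -> Prop) : Prop :=
  forall x, S x -> S (f x) /\ S (finv x).

Definition subsystem (S : A -> Prop) : Prop := closedS S /\ invariant S.

Definition nonempty (S : A -> Prop) : Prop := exists x, S x.

Definition minimal_set (S : A -> Prop) : Prop :=
  nonempty S /\ subsystem S /\
  forall S' : A -> Prop, (forall x, S' x -> S x) -> nonempty S' ->
    subsystem S' -> forall x, S x -> S' x.

Definition transitive_set (S : A -> Prop) : Prop :=
  exists x, S x /\ forall y, S y -> closure (orbit x) y.

Definition minimal_point (x : A) : Prop := minimal_set (closure (orbit x)).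

Definition M_set (S : A -> Prop) : Prop :=
  subsystem S /\ transitive_set S /\
  forall y, S y -> closure (fun x => S x /\ minimal_point x) y.
End Generic.

Record tds := TDS {
  pt :> Type;
  rho : pt -> pt -> R;
  rho_ge0 : forall x y, 0 <= rho x y;
  rho_eq0 : forall x y, rho x y = 0 <-> x = y;
  rho_sym : forall x y, rho x y = rho y x;
  rho_tri : forall x y z, rho x z <= rho x y + rho y z;
  compact : compact_space (fun x e y => rho x y < e);
  T : pt -> pt;
  Tinv : pt -> pt;
  T_Tinv : forall x, T (Tinv x) = x;
  Tinv_T : forall x, Tinv (T x) = x;
  T_cont : forall x e, 0 < e -> exists d, 0 < d /\
             forall y, rho x y < d -> rho (T x) (T y) < e;
  Tinv_cont : forall x e, 0 < e -> exists d, 0 < d /\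
             forall y, rho x y < d -> rho (Tinv x) (Tinv y) < e
}.

Definition ball (X : tds) (x : X) (e : R) (y : X) : Prop := rho X x y < e.

Definition Tn (X : tds) (n : Z) (x : X) : X := zpow (T X) (Tinv X) n x.

Definition minimal_tds (X : tds) : Prop :=
  minimal_set (ball X) (T X) (Tinv X) (fun _ => True).

Definition factor_map (X Y : tds) (p : X -> Y) : Prop :=
  (forall x e, 0 < e -> exists d, 0 < d /\
     forall y, rho X x y < d -> rho Y (p x) (p y) < e) /\
  (forall y : Y, exists x : X, p x = y) /\
  (forall x, p (T X x) = T Y (p x)).

Definition proximal_pair (X : tds) (x y : X) : Prop :=
  forall e, 0 < e -> forall N : nat, exists n : Z,
    (N <= Z.abs_nat n)%nat /\ rho X (Tn X n x) (Tn X n y) < e.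

Definition proximal_map (X Y : tds) (p : X -> Y) : Prop :=
  forall x1 x2, p x1 = p x2 -> proximal_pair X x1 x2.

Definition equicontinuous_map (X Y : tds) (p : X -> Y) : Prop :=
  forall e, 0 < e -> exists d, 0 < d /\
    forall x y, p x = p y -> rho X x y < d ->
      forall n : Z, rho X (Tn X n x) (Tn X n y) < e.

(* An ordinal [0, eta] is represented by a well-ordered type I with a
   least element z and a greatest element eta. *)
Definition well_order {I : Type} (lt : I -> I -> Prop) : Prop :=
  (forall i j k, lt i j -> lt j k -> lt i k) /\
  (forall i j, i = j \/ lt i j \/ lt j i) /\
  well_founded lt.

Definition strictly_PI (X : tds) : Prop :=
  minimal_tds X /\
  exists (I : Type) (lt : I -> I -> Prop) (z eta : I),
  well_order lt /\ (forall i, ~ lt i z) /\ (forall i, i = eta \/ lt i eta) /\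
  let le := fun i j => i = j \/ lt i j in
  exists (W : I -> tds) (pi : forall k i, le i k -> W k -> W i),
    (exists w : W z, forall w' : W z, w' = w) /\
    W eta = X /\
    (forall k i (h : le i k), factor_map (W k) (W i) (pi k i h)) /\
    (forall i (h : le i i) x, pi i i h x = x) /\
    (forall l k i (h1 : le k l) (h2 : le i k) (h3 : le i l) x,
        pi k i h2 (pi l k h1 x) = pi l i h3 x) /\
    (forall i j (h : le i j),
        (lt i j /\ forall k, lt i k -> le j k) ->
        proximal_map (W j) (W i) (pi j i h) \/
        equicontinuous_map (W j) (W i) (pi j i h)) /\
    (* at limit ordinals nu, W nu is the inverse limit of (W i)_{i<nu}:
       x |-> (pi nu i x)_{i<nu} is a bijection onto the compatible threads *)
    (forall nu, (exists i, lt i nu) ->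
        (forall i, lt i nu -> exists k, lt i k /\ lt k nu) ->
        forall w : forall i, lt i nu -> W i,
          (forall k i (hk : lt k nu) (hi : lt i nu) (h : le i k),
              pi k i h (w k hk) = w i hi) ->
          exists x : W nu,
            (forall i (hi : lt i nu) (h : le i nu), pi nu i h x = w i hi) /\
            (forall x' : W nu,
               (forall i (hi : lt i nu) (h : le i nu), pi nu i h x' = w i hi) ->
               x' = x)).

Definition PI_system (X : tds) : Prop :=
  minimal_tds X /\
  exists (Xt : tds) (p : Xt -> X),
    strictly_PI Xt /\ factor_map Xt X p /\ proximal_map Xt X p.

Definition Xpow (X : tds) (d : nat) : Type := fintype.ordinal d -> X.

(* coordinate i (0-based) is moved by T^(i+1) *)
Definition tau (X : tds) (d : nat) (u : Xpow X d) : Xpow X d :=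
  fun i => Nat.iter (S (fintype.nat_of_ord i)) (T X) (u i).
Definition tauinv (X : tds) (d : nat) (u : Xpow X d) : Xpow X d :=
  fun i => Nat.iter (S (fintype.nat_of_ord i)) (Tinv X) (u i).

(* product topology on X^d (balls of the max metric) *)
Definition pball (X : tds) (d : nat) (u : Xpow X d) (e : R) (v : Xpow X d) : Prop :=
  forall i, rho X (u i) (v i) < e.

Definition M_subsystem (X : tds) (d : nat) (Z : Xpow X d -> Prop) : Prop :=
  M_set (pball X d) (tau X d) (tauinv X d) Z.

Definition minimal_subsystem (X : tds) (d : nat) (Z : Xpow X d -> Prop) : Prop :=
  minimal_set (pball X d) (tau X d) (tauinv X d) Z.

(* Main.v *)
(** Say that X has property P if every M-subsystem of its d-th power is minimal.
    P holds for the trivial system and is carried up the PI tower.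

    Proximal extensions X -> Y: let z be a minimal point of Z with orbit closure
    K, and S a subsystem of Z. Both K and S lie over the minimal image of Z, so
    the fibre product of K and S over Y^d is nonempty and contains a minimal set.
    Its i-th coordinate pairs are proximal, hence equal, so K meets S and K is
    contained in S. Density of minimal points gives Z = S.

    Equicontinuous extensions: if M is a minimal subset of Z, the projection
    restricted to M is semi-open, so some translate of a transitive point z of Z
    has a nearby point of M in its own fibre; equicontinuity carries this back
    to z, so z belongs to M.

    Limits: points are separated by the projections, and compactness suffices.

    Finally P passes from the strictly PI system to its factor X, since an
    M-system lifts to an M-system: take an irreducible subsystem above it. *)

Require Import Defs.
From Stdlib Require Import Reals ZArith List.
From Stdlib Require Import Lra Lia Classical ClassicalChoice ClassicalEpsilon.
From Stdlib Require Import FunctionalExtensionality PropExtensionality.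
From mathcomp Require fintype classical_sets.

(** * Iterates, a pigeonhole principle, and minima of positive reals *)

Lemma nat_iter_cancel {A : Type} (f g : A -> A) (n : nat) (x : A) :
  (forall y, f (g y) = y) -> Nat.iter n f (Nat.iter n g x) = x.
Proof.
  intros H; revert x; induction n as [|n IH]; intros x; simpl; [reflexivity|].
  rewrite <- (Nat.iter_swap n _ g x), IH. apply H.
Qed.

(** If the last index fails at some [e0], monotonicity makes it fail at every smaller scale, so
    testing at [Rmin e e0] leaves only the earlier indices. *)
Lemma finite_pigeonhole (k : nat) (P : nat -> R -> Prop) :
  (forall r e e', e <= e' -> P r e -> P r e') ->
  (forall e, 0 < e -> exists r, (r < k)%nat /\ P r e) ->
  exists r, (r < k)%nat /\ forall e, 0 < e -> P r e.
Proof.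
  intros mono. induction k as [|k IH]; intros H.
  - destruct (H 1 Rlt_0_1) as (r & hr & _); lia.
  - destruct (classic (forall e, 0 < e -> P k e)) as [Hk|Hk].
    { exists k; split; [lia|assumption]. }
    apply not_all_ex_not in Hk as (e0 & Hk).
    apply imply_to_and in Hk as [he0 Hk].
    destruct IH as (r & hr & Hr).
    + intros e he.
      destruct (H (Rmin e e0)) as (r & hr & Hr); [now apply Rmin_pos|].
      exists r; split; [|now apply mono with (2 := Hr), Rmin_l].
      assert (r <> k); [|lia].
      intros ->. apply Hk. apply mono with (2 := Hr), Rmin_r.
    + exists r; split; [lia|assumption].
Qed.

Lemma list_min_pos {J : Type} (f : J -> R) (l : list J) :
  (forall j, 0 < f j) -> exists e, 0 < e /\ forall j, In j l -> e <= f j.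
Proof.
  intros H; induction l as [|a l (e & he & IH)].
  - exists 1; split; [lra|contradiction].
  - exists (Rmin (f a) e); split; [now apply Rmin_pos|].
    intros j [->|hj]; [apply Rmin_l|].
    eapply Rle_trans; [apply Rmin_r|now apply IH].
Qed.

(** * Compact metric dynamics *)

Section System.
Context (A : tds).

Notation cl := (closure (ball A)).
Notation closed := (closedS (ball A)).
Notation orb := (orbit (T A) (Tinv A)).
Notation inv := (invariant (T A) (Tinv A)).
Notation sub := (subsystem (ball A) (T A) (Tinv A)).
Notation minset := (minimal_set (ball A) (T A) (Tinv A)).
Notation minpt := (minimal_point (ball A) (T A) (Tinv A)).

Lemma rho_refl (x : A) : rho A x x = 0.
Proof. now apply rho_eq0. Qed.

Lemma subset_closure (S : A -> Prop) (x : A) : S x -> cl S x.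
Proof.
  intros H e he; exists x; split; [assumption|].
  unfold ball; rewrite rho_refl; assumption.
Qed.

Lemma closure_closed (S : A -> Prop) : closed (cl S).
Proof.
  intros x Hx e he.
  destruct (Hx (e / 2)) as (y & Hy & hxy); [lra|].
  destruct (Hy (e / 2)) as (w & Hw & hyw); [lra|].
  exists w; split; [assumption|]. unfold ball in *.
  pose proof (rho_tri A x y w); lra.
Qed.

Lemma closure_least (S S' : A -> Prop) :
  closed S' -> (forall x, S x -> S' x) -> forall x, cl S x -> S' x.
Proof.
  intros HS' H x Hx. apply HS'. intros e he.
  destruct (Hx e he) as (y & hy & hxy); exists y; auto.
Qed.

(** * Integer iterates, orbit closures and subsystems *)

Lemma Tn_succ (n : Z) (x : A) : Tn A (Z.succ n) x = T A (Tn A n x).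
Proof.
  unfold Tn. destruct n as [|p|p].
  - reflexivity.
  - simpl. rewrite Pos.add_1_r, Pos2Nat.inj_succ; reflexivity.
  - destruct p as [|p _] using Pos.peano_ind.
    + simpl. now rewrite T_Tinv.
    + replace (Z.succ (Z.neg (Pos.succ p))) with (Z.neg p) by lia.
      cbn [zpow]. rewrite Pos2Nat.inj_succ. simpl. now rewrite T_Tinv.
Qed.

Lemma Tn_pred (n : Z) (x : A) : Tn A (Z.pred n) x = Tinv A (Tn A n x).
Proof.
  rewrite <- (Z.succ_pred n) at 2. now rewrite Tn_succ, Tinv_T.
Qed.

Lemma Tn_ind (P : A -> Prop) (x : A) :
  P x -> (forall y, P y -> P (T A y) /\ P (Tinv A y)) -> forall n, P (Tn A n x).
Proof.
  intros H0 HS. refine (Z.peano_ind _ _ _ _); [exact H0| |]; intros n IH.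
  - rewrite Tn_succ; now apply HS.
  - rewrite Tn_pred; now apply HS.
Qed.

Lemma Tn_add (m n : Z) (x : A) : Tn A (m + n) x = Tn A m (Tn A n x).
Proof.
  revert m. refine (Z.peano_ind _ _ _ _); [reflexivity| |]; intros m IH.
  - now rewrite Z.add_succ_l, !Tn_succ, IH.
  - now rewrite Z.add_pred_l, !Tn_pred, IH.
Qed.

Lemma Tn_opp (n : Z) (x : A) : Tn A (- n) (Tn A n x) = x.
Proof. now rewrite <- Tn_add, Z.add_opp_diag_l. Qed.

Lemma Tn_cont (n : Z) (x : A) (e : R) : 0 < e -> exists d, 0 < d /\
  forall y, rho A x y < d -> rho A (Tn A n x) (Tn A n y) < e.
Proof.
  revert n e.
  refine (Z.peano_ind _ _ _ _).
  - intros e he; exists e; auto.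
  - intros n IH e he.
    destruct (T_cont A (Tn A n x) e he) as (d & hd & Hd).
    destruct (IH d hd) as (d' & hd' & Hd'). exists d'; split; [assumption|].
    intros y hy. rewrite !Tn_succ. auto.
  - intros n IH e he.
    destruct (Tinv_cont A (Tn A n x) e he) as (d & hd & Hd).
    destruct (IH d hd) as (d' & hd' & Hd'). exists d'; split; [assumption|].
    intros y hy. rewrite !Tn_pred. auto.
Qed.

Lemma subsystem_Tn (S : A -> Prop) (n : Z) (x : A) :
  sub S -> S x -> S (Tn A n x).
Proof. intros [_ HS] Hx. apply (Tn_ind S); auto. Qed.

Lemma orbit_invariant (x : A) : inv (orb x).
Proof.
  intros y (n & ->); split.
  - exists (Z.succ n). symmetry; apply Tn_succ.
  - exists (Z.pred n). symmetry; apply Tn_pred.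
Qed.

Lemma closure_subsystem (S : A -> Prop) : inv S -> sub (cl S).
Proof.
  intros H; split; [apply closure_closed|].
  intros x Hx; split; intros e he.
  - destruct (T_cont A x e he) as (d & hd & Hd).
    destruct (Hx d hd) as (y & hy & hxy).
    exists (T A y); split; [now apply H|now apply Hd].
  - destruct (Tinv_cont A x e he) as (d & hd & Hd).
    destruct (Hx d hd) as (y & hy & hxy).
    exists (Tinv A y); split; [now apply H|now apply Hd].
Qed.

Lemma orbit_closure_subsystem (x : A) : sub (cl (orb x)).
Proof. apply closure_subsystem, orbit_invariant. Qed.

Lemma orbit_closure_self (x : A) : cl (orb x) x.
Proof. apply subset_closure. now exists 0%Z. Qed.

Lemma orbit_closure_least (S : A -> Prop) (x : A) :
  sub S -> S x -> forall y, cl (orb x) y -> S y.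
Proof.
  intros HS Hx. apply closure_least; [apply HS|].
  intros y (n & ->). now apply (subsystem_Tn S n x).
Qed.

Lemma subsystem_inter (S S' : A -> Prop) :
  sub S -> sub S' -> sub (fun x => S x /\ S' x).
Proof.
  intros [H1 H2] [H1' H2']; split.
  - intros x Hx; split; [apply H1|apply H1']; intros e he;
      destruct (Hx e he) as (y & [] & ?); eauto.
  - intros x [Hx Hx']. destruct (H2 x Hx), (H2' x Hx'); auto.
Qed.

Lemma minimal_set_point (S : A -> Prop) (x : A) : minset S -> S x -> minpt x.
Proof.
  intros (HS0 & HS & Hmin) Hx. split; [exists x; apply orbit_closure_self|].
  split; [apply orbit_closure_subsystem|].
  intros S' HS' H0 Hsub y Hy. apply (Hmin S'); auto.
  - intros w Hw. apply (orbit_closure_least S x); auto.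
  - now apply (orbit_closure_least S x).
Qed.

(** * Consequences of compactness: intersections, minimal subsystems, covers *)

Lemma finite_intersection (J : Type) (C : J -> A -> Prop) :
  inhabited J -> (forall j, closed (C j)) -> (forall j, exists x, C j x) ->
  (forall i j, exists k, forall x, C k x -> C i x /\ C j x) ->
  exists x, forall j, C j x.
Proof.
  intros [j0] Hcl Hne Hdir. apply NNPP; intros Hno.
  destruct (Defs.compact A J (fun j x => ~ C j x)) as (l & Hl).
  - intros j x Hx.
    apply NNPP; intros H. apply Hx, Hcl. intros e he.
    apply NNPP; intros H'. apply H. exists e; split; [assumption|].
    intros y hy hC. apply H'. now exists y.
  - intros x. apply NNPP; intros H. apply Hno. exists x. intros j.
    apply NNPP; intros H'. apply H. now exists j.
  (* The complements indexed by [l] cover the space, yet by directedness some nonempty [C k] avoids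
     all of them; [j0] serves the empty list. *)
  - assert (Hk : exists k, forall x, C k x -> forall j, In j l -> C j x).
    { clear Hl. induction l as [|a l (k & Hk)].
      - exists j0. contradiction.
      - destruct (Hdir a k) as (k' & Hk'). exists k'.
        intros x Hx j [<-|hj]; [now apply Hk'|].
        apply (Hk x); [now apply Hk'|assumption]. }
    destruct Hk as (k & Hk). destruct (Hne k) as (x & Hx).
    destruct (Hl x) as (j & hj & Hj). eauto.
Qed.

(* The sets [S /\ f <= e], [e > 0], are nested. *)
Lemma closed_attains_zero (S : A -> Prop) (f : A -> R) :
  closed S -> (forall e, closed (fun x => f x <= e)) ->
  (forall e, 0 < e -> exists x, S x /\ f x <= e) ->
  exists x, S x /\ f x <= 0.
Proof.
  intros HS Hf H.
  destruct (finite_intersection {e : R | 0 < e}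
              (fun e x => S x /\ f x <= proj1_sig e)) as (x & Hx).
  - constructor; exists 1; lra.
  - intros e x Hx; split; [apply HS|apply (Hf (proj1_sig e))];
      intros e' he'; destruct (Hx e' he') as (y & [] & ?); eauto.
  - intros [e he]; auto.
  - intros [e he] [e' he'].
    exists (exist _ (Rmin e e') (Rmin_pos _ _ he he')). simpl.
    intros x [Hx Hle]. pose proof (Rmin_l e e'); pose proof (Rmin_r e e').
    repeat split; auto; lra.
  - assert (h1 : 0 < 1) by lra.
    exists x; split; [apply (Hx (exist _ 1 h1))|].
    apply Rnot_lt_le; intros hlt.
    assert (hh : 0 < f x / 2) by lra.
    destruct (Hx (exist _ (f x / 2) hh)) as [_ h]. simpl in h. lra.
Qed.

(** Zorn's lemma under reverse inclusion; closedness of [F] keeps the intersection of a chain in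
    contact with [F]. With [F] the whole space this yields minimal sets, with [F] a fibre it yields
    the irreducible subsystem used for lifting. *)
Lemma minimal_subsystem_meeting (F S : A -> Prop) :
  closed F -> sub S -> (exists x, S x /\ F x) ->
  exists M : A -> Prop, (forall x, M x -> S x) /\ sub M /\
    (exists x, M x /\ F x) /\
    forall S' : A -> Prop, (forall x, S' x -> M x) -> sub S' ->
      (exists x, S' x /\ F x) -> forall x, M x -> S' x.
Proof.
  intros HF HS HSF.
  pose (Q := fun M : A -> Prop =>
    (forall x, M x -> S x) /\ sub M /\ exists x, M x /\ F x).
  pose (D := {M : A -> Prop | Q M}).
  assert (HQS : Q S) by (split; auto).
  (* [le M M'] means that [M'] is contained in [M], so a maximal element is a smallest set; excluded
     middle turns inclusion into a boolean. *)
  pose (le := fun M M' : D =>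
    if excluded_middle_informative (forall x, proj1_sig M' x -> proj1_sig M x)
    then true else false).
  assert (leP : forall M M', is_true (le M M') <->
            (forall x, proj1_sig M' x -> proj1_sig M x)).
  { intros M M'; unfold le.
    destruct (excluded_middle_informative _) as [h|h]; split;
      intros h'; easy. }
  destruct (@classical_sets.ZL_preorder D (exist _ S HQS) le) as (M & HM).
  - intros M; now apply leP.
  - intros M1 M2 M3 H1 H2. rewrite leP in *. auto.
  - intros C HC.
    destruct (classic (exists M, C M)) as [[M0 HM0]|Hemp].
    2:{ exists (exist _ S HQS). intros M HM. elim Hemp; now exists M. }
    pose (N := fun x => forall M, C M -> proj1_sig M x).
    assert (HQN : Q N).
    { split; [|split; [split|]].
      - intros x Hx. apply (proj1 (proj2_sig M0)), Hx, HM0.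
      - intros x Hx M HM. destruct (proj2_sig M) as (_ & [Hcl _] & _).
        apply Hcl. intros e he. destruct (Hx e he) as (y & Hy & ?).
        exists y; split; auto.
      - intros x Hx; split; intros M HM;
          destruct (proj2_sig M) as (_ & [_ Hinv] & _);
          now apply (Hinv x), Hx.
      - destruct (finite_intersection {M : D | C M}
          (fun M x => proj1_sig (proj1_sig M) x /\ F x)) as (x & Hx).
        + constructor. now exists M0.
        + intros [M HM] x Hx. simpl.
          destruct (proj2_sig M) as (_ & [Hcl _] & _).
          split; [apply Hcl|apply HF];
            intros e' he'; destruct (Hx e' he') as (y & [] & ?); eauto.
        + intros [M HM]. apply (proj2_sig M).
        + intros [M1 H1] [M2 H2]. simpl.
          destruct (HC M1 M2 H1 H2) as [h|h]; rewrite leP in h.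
          * exists (exist _ M2 H2). simpl. firstorder.
          * exists (exist _ M1 H1). simpl. firstorder.
        + exists x; split.
          * intros M HM. apply (Hx (exist _ M HM)).
          * apply (Hx (exist _ M0 HM0)). }
    exists (exist _ N HQN). intros M HM. apply leP. simpl.
    intros x Hx. now apply Hx.
  - destruct M as [M HQM]. exists M.
    destruct HQM as (H1 & H2 & H3) eqn:E. repeat (split; [assumption|]).
    intros S' HS' Hsub Hne.
    assert (HQ' : Q S') by (split; auto).
    specialize (HM (exist _ S' HQ')). rewrite !leP in HM. simpl in HM. auto.
Qed.

Lemma exists_minimal_set (S : A -> Prop) :
  sub S -> (exists x, S x) ->
  exists M, (forall x, M x -> S x) /\ minset M.
Proof.
  intros HS [x0 Hx0].
  destruct (minimal_subsystem_meeting (fun _ => True) S)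
    as (M & HMS & HM & [x [Hx _]] & Hmin); [easy|assumption|now exists x0|].
  exists M; split; [assumption|]. split; [now exists x|].
  split; [assumption|].
  intros S' HS' [y Hy] Hsub. apply Hmin; auto. now exists y.
Qed.

(* Either the first closed set contains the whole ball, or it misses a smaller
   ball, which is then covered by the remaining sets. *)
Lemma finite_baire (J : Type) (Y : A -> Prop) (C : J -> A -> Prop) (l : list J) :
  (forall j, closed (C j)) ->
  forall (y : A) (r : R), Y y -> 0 < r ->
  (forall y', Y y' -> rho A y y' < r -> exists j, In j l /\ C j y') ->
  exists j y0 r0, In j l /\ Y y0 /\ 0 < r0 /\
    forall y', Y y' -> rho A y0 y' < r0 -> C j y'.
Proof.
  intros Hcl. induction l as [|a l IH]; intros y r Hy hr Hcov.
  - destruct (Hcov y Hy) as (j & [] & _). now rewrite rho_refl.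
  - destruct (classic (exists y', Y y' /\ rho A y y' < r /\ ~ C a y'))
      as [(y1 & Hy1 & hr1 & Hn)|Hall].
    + assert (Hop : exists e, 0 < e /\ forall y', rho A y1 y' < e -> ~ C a y').
      { apply NNPP; intros H. apply Hn, Hcl. intros e he.
        apply NNPP; intros H'. apply H. exists e; split; [assumption|].
        intros y' h h'. apply H'. now exists y'. }
      destruct Hop as (e & he & Hop).
      destruct (IH y1 (Rmin e (r - rho A y y1)) Hy1) as (j & y0 & r0 & hj & H).
      * apply Rmin_pos; lra.
      * intros y' Hy' h.
        pose proof (Rmin_l e (r - rho A y y1)).
        pose proof (Rmin_r e (r - rho A y y1)).
        pose proof (rho_tri A y y1 y').
        destruct (Hcov y' Hy') as (j & [<-|hj] & Hj); [lra| |now exists j].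
        elim (Hop y'); [lra|assumption].
      * exists j, y0, r0; split; [now right|assumption].
    + exists a, y, r. split; [now left|]. repeat split; auto.
      intros y' Hy' h. apply NNPP; intros H. apply Hall. now exists y'.
Qed.

(** Every orbit closure in [M] is all of [M], so each point of [M] enters the ball about [m] at some
    time. These open conditions, enlarged by the complement of [M] so as to cover the whole space,
    admit a finite subcover. *)
Lemma minimal_set_syndetic (M : A -> Prop) (m : A) (d : R) :
  minset M -> M m -> 0 < d ->
  exists l : list Z, forall x, M x ->
    exists n, In n l /\ rho A m (Tn A n x) < d.
Proof.
  intros (_ & HM & Hmin) Hm hd.
  destruct (Defs.compact A Z (fun n x => ~ M x \/ rho A m (Tn A n x) < d))
    as (l & Hl).
  - intros n x [Hx|Hx].
    + apply NNPP; intros H. apply Hx, HM. intros e he.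
      apply NNPP; intros H'. apply H. exists e; split; [assumption|].
      intros y h. left; intros h'. apply H'. now exists y.
    + destruct (Tn_cont n x (d - rho A m (Tn A n x))) as (e & he & He); [lra|].
      exists e; split; [assumption|]. intros y hy. right.
      specialize (He y hy). pose proof (rho_tri A m (Tn A n x) (Tn A n y)). lra.
  - intros x. destruct (classic (M x)) as [Hx|Hx].
    + destruct (Hmin (cl (orb x))) with (x := m) (e := d) as (y & (n & ->) & h);
        auto.
      * now apply orbit_closure_least.
      * exists x; apply orbit_closure_self.
      * apply orbit_closure_subsystem.
      * exists n; right. exact h.
    + exists 0%Z; now left.
  - exists l. intros x Hx. destruct (Hl x) as (n & hn & [h|h]); [easy|].
    now exists n.
Qed.

End System.

(** * Continuous equivariant maps, images and preimages of subsystems *)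

Definition cont (A B : tds) (p : A -> B) : Prop :=
  forall x e, 0 < e -> exists d, 0 < d /\
    forall y, rho A x y < d -> rho B (p x) (p y) < e.

(** Surjectivity is left out and assumed separately where sets are lifted. *)
Definition hom (A B : tds) (p : A -> B) : Prop :=
  cont A B p /\ forall x, p (T A x) = T B (p x).

Lemma cont_const (A B : tds) (b : B) : cont A B (fun _ => b).
Proof. intros x e he; exists 1; split; [lra|]. intros; now rewrite rho_refl. Qed.

Lemma cont_comp (A B C : tds) (p : A -> B) (q : B -> C) :
  cont A B p -> cont B C q -> cont A C (fun x => q (p x)).
Proof.
  intros Hp Hq x e he. destruct (Hq (p x) e he) as (d & hd & Hd).
  destruct (Hp x d hd) as (d' & hd' & Hd'). exists d'; auto.
Qed.

Lemma closed_dist_le (A B : tds) (f g : A -> B) (c : R) :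
  cont A B f -> cont A B g -> closedS (ball A) (fun x => rho B (f x) (g x) <= c).
Proof.
  intros Hf Hg x Hx. apply Rnot_lt_le; intros hlt.
  pose (e := (rho B (f x) (g x) - c) / 2).
  destruct (Hf x e) as (d & hd & Hd); [unfold e; lra|].
  destruct (Hg x e) as (d' & hd' & Hd'); [unfold e; lra|].
  destruct (Hx (Rmin d d')) as (y & hy & hxy); [now apply Rmin_pos|].
  unfold ball in hxy.
  pose proof (Rmin_l d d'); pose proof (Rmin_r d d').
  specialize (Hd y ltac:(lra)); specialize (Hd' y ltac:(lra)).
  pose proof (rho_tri B (f x) (f y) (g x)).
  pose proof (rho_tri B (f y) (g y) (g x)).
  rewrite (rho_sym B (g x)) in Hd'. unfold e in *. lra.
Qed.

Lemma dist_le0_eq (A : tds) (x y : A) : rho A x y <= 0 <-> x = y.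
Proof.
  rewrite <- rho_eq0. pose proof (rho_ge0 A x y). lra.
Qed.

Lemma closed_eq (A B : tds) (f g : A -> B) :
  cont A B f -> cont A B g -> closedS (ball A) (fun x => f x = g x).
Proof.
  intros Hf Hg x Hx. apply dist_le0_eq.
  apply (closed_dist_le A B f g 0 Hf Hg).
  intros e he. destruct (Hx e he) as (y & hy & ?). exists y.
  now rewrite dist_le0_eq.
Qed.

Section Hom.
Context (A B : tds) (p : A -> B).
Hypothesis Hp : hom A B p.

Notation clA := (closure (ball A)).
Notation clB := (closure (ball B)).
Notation subA := (subsystem (ball A) (T A) (Tinv A)).
Notation subB := (subsystem (ball B) (T B) (Tinv B)).
Notation minA := (minimal_set (ball A) (T A) (Tinv A)).
Notation minB := (minimal_set (ball B) (T B) (Tinv B)).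
Notation img S := (fun y => exists x, S x /\ p x = y).

Lemma hom_Tinv (x : A) : p (Tinv A x) = Tinv B (p x).
Proof.
  rewrite <- (T_Tinv A x) at 2. now rewrite (proj2 Hp), Tinv_T.
Qed.

Lemma hom_Tn (n : Z) (x : A) : p (Tn A n x) = Tn B n (p x).
Proof.
  revert n. refine (Z.peano_ind _ _ _ _); [reflexivity| |]; intros n IH.
  - now rewrite !Tn_succ, (proj2 Hp), IH.
  - now rewrite !Tn_pred, hom_Tinv, IH.
Qed.

(** For [y] adherent to the image, the distance from [y] to [p x] gets arbitrarily small on [S],
    hence vanishes somewhere by compactness. *)
Lemma image_closed (S : A -> Prop) :
  closedS (ball A) S -> closedS (ball B) (img S).
Proof.
  intros HS y Hy.
  destruct (closed_attains_zero A S (fun x => rho B y (p x))) as (x & Hx & h).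
  - assumption.
  - intros e. apply closed_dist_le; [apply cont_const|apply Hp].
  - intros e he. destruct (Hy e he) as (y' & (x & Hx & <-) & h).
    exists x; split; [assumption|]. unfold ball in h; lra.
  - exists x; split; [assumption|]. symmetry; now apply dist_le0_eq.
Qed.

Lemma image_subsystem (S : A -> Prop) : subA S -> subB (img S).
Proof.
  intros [H1 H2]; split; [now apply image_closed|].
  intros y (x & Hx & <-). destruct (H2 x Hx). split.
  - exists (T A x); split; [assumption|apply Hp].
  - exists (Tinv A x); split; [assumption|apply hom_Tinv].
Qed.

Lemma preimage_closed (S : B -> Prop) :
  closedS (ball B) S -> closedS (ball A) (fun x => S (p x)).
Proof.
  intros HS x Hx. apply HS. intros e he.
  destruct (proj1 Hp x e he) as (d & hd & Hd).
  destruct (Hx d hd) as (y & hy & hxy). exists (p y); split; auto.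
  now apply Hd.
Qed.

Lemma preimage_subsystem (S : B -> Prop) :
  subB S -> subA (fun x => S (p x)).
Proof.
  intros [H1 H2]; split; [now apply preimage_closed|].
  intros x Hx. rewrite (proj2 Hp), hom_Tinv. now apply H2.
Qed.

Lemma image_minimal (S : A -> Prop) : minA S -> minB (img S).
Proof.
  intros ((x0 & Hx0) & HS & Hmin). split; [now exists (p x0), x0|].
  split; [now apply image_subsystem|].
  intros S' HS' (y0 & Hy0) Hsub y (x & Hx & <-).
  apply (Hmin (fun x => S x /\ S' (p x))); auto; [now intros ? []| |].
  - destruct (HS' y0 Hy0) as (x1 & Hx1 & <-). now exists x1.
  - apply subsystem_inter; [assumption|now apply preimage_subsystem].
Qed.

Lemma image_minimal_point (x : A) :
  minimal_point (ball A) (T A) (Tinv A) x ->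
  minimal_point (ball B) (T B) (Tinv B) (p x).
Proof.
  intros H. apply (minimal_set_point B _ (p x) (image_minimal _ H)).
  exists x; split; [apply orbit_closure_self|reflexivity].
Qed.

(** Both density conditions transfer in the same way: the preimage of the closure wanted downstairs
    is closed and contains the dense set upstairs. *)
Lemma image_M (S : A -> Prop) :
  M_set (ball A) (T A) (Tinv A) S -> M_set (ball B) (T B) (Tinv B) (img S).
Proof.
  intros (HS & (x0 & Hx0 & Htr) & Hden).
  split; [now apply image_subsystem|]. split.
  - exists (p x0); split; [now exists x0|].
    intros y (x & Hx & <-).
    apply (closure_least A (orbit (T A) (Tinv A) x0)
             (fun x => clB (orbit (T B) (Tinv B) (p x0)) (p x)));
      [| |now apply Htr].
    + apply preimage_closed, closure_closed.
    + intros w (n & ->). apply subset_closure. exists n. apply hom_Tn.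
  - intros y (x & Hx & <-).
    apply (closure_least A (fun x => S x /\
             minimal_point (ball A) (T A) (Tinv A) x)
             (fun x => clB (fun y => img S y /\
               minimal_point (ball B) (T B) (Tinv B) y) (p x))).
    + apply preimage_closed, closure_closed.
    + intros w [Hw Hm]. apply subset_closure. split; [now exists w|].
      now apply image_minimal_point.
    + now apply Hden.
Qed.

(* An irreducible subsystem above Z is again transitive with dense minimal
   points, so minimality of M-subsystems passes to factors. *)
Lemma lift_M (Z : B -> Prop) :
  (forall y, exists x, p x = y) ->
  M_set (ball B) (T B) (Tinv B) Z ->
  exists S : A -> Prop, M_set (ball A) (T A) (Tinv A) S /\
    forall y, Z y <-> img S y.
Proof.
  intros Hsurj (HZ & (z0 & Hz0 & Htr) & Hden).
  destruct (minimal_subsystem_meeting A (fun x => p x = z0) (fun x => Z (p x)))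
    as (S & HSZ & HS & (s & Hs & Hps) & Hmin).
  { apply closed_eq; [apply Hp|apply cont_const]. }
  { now apply preimage_subsystem. }
  { destruct (Hsurj z0) as [x Hx]. exists x. now rewrite Hx. }
  assert (Himg : forall y, Z y -> img S y).
  { intros y Hy. apply (orbit_closure_least B (img S) z0).
    - now apply image_subsystem.
    - now exists s.
    - now apply Htr. }
  exists S; split.
  2:{ intros y; split; [apply Himg|]. intros (x & Hx & <-). auto. }
  split; [assumption|]. split.
  - exists s; split; [assumption|]. intros y Hy.
    (* The orbit closure of [s] still meets the fibre over [z0], so irreducibility makes it all of
       [S]. *)
    apply (Hmin (clA (orbit (T A) (Tinv A) s))); auto.
    + now apply orbit_closure_least.
    + apply orbit_closure_subsystem.
    + exists s; split; [apply orbit_closure_self|assumption].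
  - pose (D := fun x => S x /\ minimal_point (ball A) (T A) (Tinv A) x).
    assert (HD : subA (clA D)).
    { apply closure_subsystem. intros x [Hx Hm].
      destruct (proj2 HS x Hx) as [H1 H2].
      destruct (proj2 (orbit_closure_subsystem A x) x (orbit_closure_self A x)).
      split; (split; [assumption|now apply (minimal_set_point A _ _ Hm)]). }
    intros x Hx. apply (Hmin (clA D)); auto.
    + apply closure_least; [apply HS|now intros ? []].
    (* The closure of the minimal points of [S] maps onto [Z]; in particular it meets the fibre over
       [z0], as irreducibility requires. *)
    + assert (H : forall y, Z y -> img (clA D) y); [|apply (H z0 Hz0)].
      intros y Hy.
      apply (closure_least B (fun x => Z x /\
               minimal_point (ball B) (T B) (Tinv B) x) (img (clA D)));
        [| |now apply Hden].
      * apply image_closed, HD.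
      * clear y Hy x Hx. intros y [Hy Hm].
        destruct (Himg y Hy) as (x & Hx & Hpx).
        (* A minimal set in [S] above the orbit closure of the minimal point [y] has an image
           filling that closure, so it contains a point over [y]. *)
        destruct (exists_minimal_set A (fun x => S x /\
          clB (orbit (T B) (Tinv B) y) (p x))) as (M & HMS & HM).
        { apply subsystem_inter; [assumption|].
          apply preimage_subsystem, orbit_closure_subsystem. }
        { exists x; split; [assumption|]. rewrite Hpx.
          apply orbit_closure_self. }
        destruct Hm as (_ & _ & Hm).
        destruct (Hm (img M)) with (x := y) as (m & HmM & Hpm).
        { intros w (m & HmM & <-). now apply HMS. }
        { destruct HM as ((m & HmM) & _). now exists (p m), m. }
        { apply image_subsystem, HM. }
        { apply orbit_closure_self. }
        exists m; split; [|assumption]. apply subset_closure.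
        split; [now apply HMS|]. now apply (minimal_set_point A M).
Qed.

(** Two points of one fibre that are close at a single time stay close at all times. So it is enough
    to find a point of [M] near some translate of [z] and in the fibre of that translate, and to
    move both back. *)
Lemma equicontinuous_extension_minimal (Z : A -> Prop) :
  equicontinuous_map A B p -> subA Z ->
  transitive_set (ball A) (T A) (Tinv A) Z ->
  minB (img Z) -> minA Z.
Proof.
  intros Heq HZ (z & Hz & Htr) Hmin.
  split; [now exists z|]. split; [assumption|].
  intros S' HS' Hne Hsub.
  destruct (exists_minimal_set A S' Hsub Hne) as (M & HMS & HM).
  assert (HMZ : forall y, img Z y -> img M y).
  { apply (proj2 (proj2 Hmin)).
    - intros y (x & Hx & <-). exists x; auto.
    - destruct HM as ((m & HmM) & _). now exists (p m), m.
    - apply image_subsystem, HM. }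
  enough (HzM : M z).
  { intros x Hx. apply HMS.
    apply (orbit_closure_least A M z); [apply HM|assumption|now apply Htr]. }
  apply (proj1 (proj1 (proj2 HM))). intros e he.
  destruct (Heq e he) as (d & hd & Hd).
  destruct (proj1 HM) as (m & HmM).
  (* The final estimate adds three distances of at most [d / 4]. Each [n] in [l] gives the piece of
     [M] that [Tn A n] carries to within [d / 4] of [m]. *)
  destruct (minimal_set_syndetic A M m (d / 4) HM HmM) as (l & Hl); [lra|].
  (* p restricted to M is semi-open: some closed piece of M of diameter < d
     has an image with interior in p(Z). *)
  destruct (finite_baire B BinNums.Z (img M)
    (fun n y => exists x, (M x /\ rho A m (Tn A n x) <= d / 4) /\ p x = y) l)
    with (y := p m) (r := 1) as (n & y0 & r & hn & Hy0 & hr & Hint).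
  - intros n. apply image_closed. intros x Hx. split.
    + apply (proj1 (proj1 (proj2 HM))). intros e' he'.
      destruct (Hx e' he') as (y & [] & ?); eauto.
    + apply (closed_dist_le A A (fun _ => m) (Tn A n)).
      * apply cont_const.
      * intros x' e' he'. now apply Tn_cont.
      * intros e' he'. destruct (Hx e' he') as (y & [] & ?); eauto.
  - now exists m.
  - lra.
  - intros y' (x & Hx & <-) _. destruct (Hl x Hx) as (n & hn & h).
    exists n; split; [assumption|]. exists x; split; [split|]; auto; lra.
  - destruct (Hint y0 Hy0) as (x0 & [Hx0 hx0] & Hpx0).
    { now rewrite rho_refl. }
    destruct (proj1 Hp x0 r hr) as (d1 & hd1 & Hd1).
    destruct (Tn_cont A n x0 (d / 4)) as (d2 & hd2 & Hd2); [lra|].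
    (* [d1] puts the image of [Tn A k z] in the ball about [y0], hence in the image of the chosen
       piece; [d2] keeps [Tn A k z] and [x0] within [d / 4] after time [n]. *)
    destruct (Htr x0) with (e := Rmin d1 d2) as (w & (k & ->) & h).
    { auto. }
    { now apply Rmin_pos. }
    change (zpow (T A) (Tinv A) k z) with (Tn A k z) in h.
    unfold ball in h.
    pose proof (Rmin_l d1 d2); pose proof (Rmin_r d1 d2).
    specialize (Hd1 (Tn A k z) ltac:(lra)).
    specialize (Hd2 (Tn A k z) ltac:(lra)).
    destruct (Hint (p (Tn A k z))) as (x1 & [Hx1 hx1] & Hpx1).
    { apply HMZ. exists (Tn A k z); split; [|reflexivity].
      now apply subsystem_Tn. }
    { now rewrite <- Hpx0. }
    (* At time [n + k] the orbit of [z] shares its fibre with [Tn A n x1], at distance below [d];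
       equicontinuity is applied at time [- (n + k)]. *)
    exists (Tn A (- (n + k)) (Tn A n x1)); split.
    { apply subsystem_Tn; [apply HM|]. apply subsystem_Tn; [apply HM|assumption]. }
    unfold ball. rewrite <- (Tn_opp A (n + k) z) at 1.
    apply Hd.
    + now rewrite Tn_add, (hom_Tn n x1), Hpx1, hom_Tn.
    + rewrite Tn_add.
      pose proof (rho_tri A (Tn A n (Tn A k z)) (Tn A n x0) (Tn A n x1)).
      pose proof (rho_tri A (Tn A n x0) m (Tn A n x1)).
      pose proof (rho_sym A (Tn A n (Tn A k z)) (Tn A n x0)).
      pose proof (rho_sym A (Tn A n x0) m). lra.
Qed.

End Hom.

(** For [z] in [Z], minimality of the images lets [S] meet each fibre of [p j] through [z]. These
    closed intersections are directed, and by separation a common point can only be [z]. *)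
Lemma separated_limit_minimal (A : tds) (J : Type) (B : J -> tds)
  (p : forall j, A -> B j) (Z : A -> Prop) :
  inhabited J -> (forall j, hom A (B j) (p j)) ->
  (forall i j, exists k, forall x y, p k x = p k y ->
     p i x = p i y /\ p j x = p j y) ->
  (forall x y, (forall j, p j x = p j y) -> x = y) ->
  (exists x, Z x) -> subsystem (ball A) (T A) (Tinv A) Z ->
  (forall j, minimal_set (ball (B j)) (T (B j)) (Tinv (B j))
     (fun y => exists x, Z x /\ p j x = y)) ->
  minimal_set (ball A) (T A) (Tinv A) Z.
Proof.
  intros HJ Hp Hdir Hsep HZne HZ Hmin. split; [assumption|].
  split; [assumption|]. intros S HSZ [s Hs] HS z Hz.
  destruct (finite_intersection A J (fun j x => S x /\ p j x = p j z))
    as (x & Hx); auto.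
  - intros j x Hx. split.
    + apply (proj1 HS). intros e he.
      destruct (Hx e he) as (y & [] & ?); eauto.
    + apply (closed_eq A (B j) (p j) (fun _ => p j z));
        [apply Hp|apply cont_const|].
      intros e he. destruct (Hx e he) as (y & [] & ?); eauto.
  - intros j.
    apply (proj2 (proj2 (Hmin j)) (fun y => exists x, S x /\ p j x = y)).
    + intros y (x & Hx & <-). exists x; auto.
    + now exists (p j s), s.
    + now apply image_subsystem.
    + now exists z.
  - intros i j. destruct (Hdir i j) as (k & Hk). exists k.
    intros x [Hx Hpx]. destruct (Hk x z Hpx). auto.
  - destruct HJ as [j0]. rewrite <- (Hsep x z); [apply (Hx j0)|].
    intros j; apply Hx.
Qed.

(** * Finite powers *)

Section Power.
Context (I : Type) (l : list I) (Hl : forall i, In i l) (X : tds) (ex : I -> nat).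

(** The maximum metric; starting from 0 also covers an empty index type. *)
Definition pow_dist (u v : I -> X) : R :=
  fold_right (fun i => Rmax (rho X (u i) (v i))) 0 l.

Lemma pow_dist_ge0 (u v : I -> X) : 0 <= pow_dist u v.
Proof.
  unfold pow_dist. clear Hl. induction l as [|a s IH]; simpl; [lra|].
  eapply Rle_trans; [exact IH|apply Rmax_r].
Qed.

Lemma pow_dist_coord (u v : I -> X) (i : I) : rho X (u i) (v i) <= pow_dist u v.
Proof.
  unfold pow_dist. specialize (Hl i). induction l as [|a s IH]; [easy|].
  simpl. destruct Hl as [->|h]; [apply Rmax_l|].
  eapply Rle_trans; [now apply IH|apply Rmax_r].
Qed.

Lemma pow_dist_le (u v : I -> X) (c : R) : 0 <= c ->
  (forall i, rho X (u i) (v i) <= c) -> pow_dist u v <= c.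
Proof.
  intros hc H. unfold pow_dist. clear Hl.
  induction l as [|a s IH]; simpl; [assumption|]. now apply Rmax_lub.
Qed.

Lemma pow_dist_lt (u v : I -> X) (c : R) : 0 < c ->
  (pow_dist u v < c <-> forall i, rho X (u i) (v i) < c).
Proof.
  intros hc; split; intros H.
  - intros i. eapply Rle_lt_trans; [apply pow_dist_coord|assumption].
  - unfold pow_dist. clear Hl.
    induction l as [|a s IH]; simpl; [assumption|]. now apply Rmax_lub_lt.
Qed.

Lemma pow_dist_eq0 (u v : I -> X) : pow_dist u v = 0 <-> u = v.
Proof.
  split.
  - intros H. extensionality i. apply dist_le0_eq. rewrite <- H.
    apply pow_dist_coord.
  - intros ->. apply Rle_antisym; [|apply pow_dist_ge0].
    apply pow_dist_le; [lra|]. intros i. rewrite rho_refl; lra.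
Qed.

Lemma pow_dist_sym (u v : I -> X) : pow_dist u v = pow_dist v u.
Proof.
  unfold pow_dist. f_equal. extensionality i. now rewrite rho_sym.
Qed.

Lemma pow_dist_tri (u v w : I -> X) :
  pow_dist u w <= pow_dist u v + pow_dist v w.
Proof.
  pose proof (pow_dist_ge0 u v); pose proof (pow_dist_ge0 v w).
  apply pow_dist_le; [lra|]. intros i.
  pose proof (rho_tri X (u i) (v i) (w i)).
  pose proof (pow_dist_coord u v i); pose proof (pow_dist_coord v w i). lra.
Qed.

(* The tube lemma, applied to one coordinate at a time; [u] is the base point of
   the slice whose free directions are those in [s]. *)
Lemma slice_finite_cover (J : Type) (U : J -> (I -> X) -> Prop) (s : list I) :
  (forall j, openS (fun x e y => pow_dist x y < e) (U j)) ->
  (forall x, exists j, U j x) ->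
  forall u, exists e (lj : list J), 0 < e /\
    forall v, (forall i, ~ In i s -> rho X (u i) (v i) < e) ->
      exists j, In j lj /\ U j v.
Proof.
  intros Hop Hcov. induction s as [|a s IH]; intros u.
  - destruct (Hcov u) as [j Hj]. destruct (Hop j u Hj) as (e & he & He).
    exists e, (j :: nil); split; [assumption|].
    intros v Hv. exists j; split; [now left|]. apply He.
    apply pow_dist_lt; auto.
  - pose (upd := fun x i => if excluded_middle_informative (i = a) then x else u i).
    destruct (choice (fun x (q : R * list J) => 0 < fst q /\
      forall v, (forall i, ~ In i s -> rho X (upd x i) (v i) < fst q) ->
        exists j, In j (snd q) /\ U j v)) as (F & HF).
    { intros x. destruct (IH (upd x)) as (e & lj & H). now exists (e, lj). }
    (* Each value [x] of coordinate [a] has a tube of width [fst (F x)]. Finitely many of these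
       widths cover the axis, and their minimum bounds the remaining coordinates. *)
    destruct (Defs.compact X X (fun x y => rho X x y < fst (F x))) as (lx & Hlx).
    { intros x y hxy. exists (fst (F x) - rho X x y); split; [lra|].
      intros w hw. pose proof (rho_tri X x y w); lra. }
    { intros x. exists x. rewrite rho_refl. apply HF. }
    destruct (list_min_pos (fun x => fst (F x)) lx) as (e & he & Hmin).
    { intros x; apply HF. }
    exists e, (flat_map (fun x => snd (F x)) lx); split; [assumption|].
    intros v Hv. destruct (Hlx (v a)) as (x & Hx & hx).
    destruct (proj2 (HF x) v) as (j & hj & Hj).
    { intros i hi. unfold upd.
      destruct (excluded_middle_informative (i = a)) as [->|hne]; [assumption|].
      apply Rlt_le_trans with e; [|now apply Hmin].
      apply Hv. intros [h|h]; auto. }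
    exists j; split; [|assumption]. apply in_flat_map. now exists x.
Qed.

Lemma pow_compact : compact_space (fun x e y => pow_dist x y < e).
Proof.
  intros J U Hop Hcov.
  destruct (classic (exists u : I -> X, True)) as [[u _]|Hno].
  (* With every direction in [l] free, the closeness condition is vacuous and the slice is the whole
     power. *)
  - destruct (slice_finite_cover J U l Hop Hcov u) as (e & lj & he & H).
    exists lj. intros v. apply H. intros i hi. elim hi; auto.
  - exists nil. intros x. elim Hno; now exists x.
Qed.

Lemma iter_T (k : nat) (x : X) : Nat.iter k (T X) x = Tn X (Z.of_nat k) x.
Proof.
  induction k as [|k IH]; [reflexivity|].
  now rewrite Nat2Z.inj_succ, Tn_succ, <- IH.
Qed.

Lemma iter_Tinv (k : nat) (x : X) : Nat.iter k (Tinv X) x = Tn X (- Z.of_nat k) x.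
Proof.
  induction k as [|k IH]; [reflexivity|].
  now rewrite Nat2Z.inj_succ, Z.opp_succ, Tn_pred, <- IH.
Qed.

Lemma pow_Tn_cont (c : I -> Z) (u : I -> X) (e : R) : 0 < e ->
  exists d, 0 < d /\ forall v, pow_dist u v < d ->
    pow_dist (fun i => Tn X (c i) (u i)) (fun i => Tn X (c i) (v i)) < e.
Proof.
  intros he.
  destruct (choice (fun i d => 0 < d /\ forall y, rho X (u i) y < d ->
    rho X (Tn X (c i) (u i)) (Tn X (c i) y) < e)) as (D & HD).
  { intros i; now apply Tn_cont. }
  destruct (list_min_pos D l) as (d & hd & Hd); [intros i; apply HD|].
  exists d; split; [assumption|]. intros v hv.
  apply pow_dist_lt; [assumption|]. intros i. apply HD.
  apply Rlt_le_trans with d; [|now apply Hd].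
  now apply pow_dist_lt.
Qed.

Definition pow_T (u : I -> X) : I -> X := fun i => Nat.iter (ex i) (T X) (u i).
Definition pow_Tinv (u : I -> X) : I -> X :=
  fun i => Nat.iter (ex i) (Tinv X) (u i).

Lemma pow_T_Tinv (u : I -> X) : pow_T (pow_Tinv u) = u.
Proof. extensionality i. apply nat_iter_cancel, T_Tinv. Qed.

Lemma pow_Tinv_T (u : I -> X) : pow_Tinv (pow_T u) = u.
Proof. extensionality i. apply nat_iter_cancel, Tinv_T. Qed.

Lemma pow_T_cont (u : I -> X) (e : R) : 0 < e -> exists d, 0 < d /\
  forall v, pow_dist u v < d -> pow_dist (pow_T u) (pow_T v) < e.
Proof.
  intros he. destruct (pow_Tn_cont (fun i => Z.of_nat (ex i)) u e he)
    as (d & hd & Hd). exists d; split; [assumption|]. intros v hv.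
  replace (pow_T u) with (fun i => Tn X (Z.of_nat (ex i)) (u i))
    by (extensionality i; symmetry; apply iter_T).
  replace (pow_T v) with (fun i => Tn X (Z.of_nat (ex i)) (v i))
    by (extensionality i; symmetry; apply iter_T).
  auto.
Qed.

Lemma pow_Tinv_cont (u : I -> X) (e : R) : 0 < e -> exists d, 0 < d /\
  forall v, pow_dist u v < d -> pow_dist (pow_Tinv u) (pow_Tinv v) < e.
Proof.
  intros he. destruct (pow_Tn_cont (fun i => - Z.of_nat (ex i))%Z u e he)
    as (d & hd & Hd). exists d; split; [assumption|]. intros v hv.
  replace (pow_Tinv u) with (fun i => Tn X (- Z.of_nat (ex i)) (u i))
    by (extensionality i; symmetry; apply iter_Tinv).
  replace (pow_Tinv v) with (fun i => Tn X (- Z.of_nat (ex i)) (v i))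
    by (extensionality i; symmetry; apply iter_Tinv).
  auto.
Qed.

(** Index type and exponents stay general so that the construction gives both the power of [X] under
    [tau] and the product of two copies of it. *)
Definition power : tds :=
  TDS (I -> X) pow_dist pow_dist_ge0 pow_dist_eq0 pow_dist_sym pow_dist_tri
    pow_compact pow_T pow_Tinv pow_T_Tinv pow_Tinv_T pow_T_cont pow_Tinv_cont.

Lemma power_Tn (n : Z) (u : power) (i : I) :
  Tn power n u i = Tn X (n * Z.of_nat (ex i)) (u i).
Proof.
  revert n. refine (Z.peano_ind _ _ _ _); [reflexivity| |]; intros n IH.
  - rewrite Tn_succ. simpl. unfold pow_T.
    rewrite IH, iter_T, <- Tn_add. f_equal. lia.
  - rewrite Tn_pred. simpl. unfold pow_Tinv.
    rewrite IH, iter_Tinv, <- Tn_add. f_equal. lia.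
Qed.

Lemma power_coord_cont (i : I) : cont power X (fun u => u i).
Proof.
  intros u e he. exists e; split; [assumption|]. intros v hv.
  now apply pow_dist_lt.
Qed.

End Power.

(** * Extensions of powers *)

Section PowerMaps.
Context (I : Type) (l : list I) (Hl : forall i, In i l) (ex : I -> nat).

Notation pow X := (power I l Hl X ex).

Definition pow_map {X Y : tds} (p : X -> Y) (u : pow X) : pow Y :=
  fun i => p (u i).

(** Property P of the overview holds for [X] when this holds for [pow X]. *)
Definition M_implies_minimal (A : tds) : Prop :=
  forall Z : A -> Prop, M_set (ball A) (T A) (Tinv A) Z ->
    minimal_set (ball A) (T A) (Tinv A) Z.

Lemma pow_map_hom (X Y : tds) (p : X -> Y) :
  hom X Y p -> hom (pow X) (pow Y) (pow_map p).
Proof.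
  intros [Hc Hp]; split.
  - intros u e he.
    destruct (choice (fun i d => 0 < d /\ forall y, rho X (u i) y < d ->
      rho Y (p (u i)) (p y) < e)) as (D & HD).
    { intros i; now apply Hc. }
    destruct (list_min_pos D l) as (d & hd & Hd); [intros i; apply HD|].
    exists d; split; [assumption|]. intros v hv.
    apply pow_dist_lt; [assumption|assumption|]. intros i. apply HD.
    apply Rlt_le_trans with d; [|now apply Hd].
    now apply (pow_dist_lt I l Hl).
  - intros u. extensionality i. apply Nat.iter_swap_gen. apply Hp.
Qed.

(** Time [n] of the product acts on coordinate [i] as time [n * ex i], and the bound on [X] is
    uniform over all integer times. *)
Lemma pow_map_equicontinuous (X Y : tds) (p : X -> Y) :
  equicontinuous_map X Y p -> equicontinuous_map (pow X) (pow Y) (pow_map p).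
Proof.
  intros H e he. destruct (H e he) as (d & hd & Hd).
  exists d; split; [assumption|]. intros u v Huv huv n.
  apply pow_dist_lt; [assumption|assumption|]. intros i.
  rewrite !power_Tn. apply Hd.
  - exact (equal_f Huv i).
  - now apply (pow_dist_lt I l Hl).
Qed.

Lemma equicontinuous_step (X Y : tds) (p : X -> Y) :
  hom X Y p -> equicontinuous_map X Y p ->
  M_implies_minimal (pow Y) -> M_implies_minimal (pow X).
Proof.
  intros Hp Heq HY Z HZ. pose proof (pow_map_hom X Y p Hp) as Hh.
  apply (equicontinuous_extension_minimal (pow X) (pow Y) (pow_map p) Hh).
  - now apply pow_map_equicontinuous.
  - apply HZ.
  - apply HZ.
  - apply HY. now apply image_M.
Qed.

Lemma factor_step (X Y : tds) (p : X -> Y) :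
  hom X Y p -> (forall y, exists x, p x = y) ->
  M_implies_minimal (pow X) -> M_implies_minimal (pow Y).
Proof.
  intros Hp Hsurj HX Z HZ. pose proof (pow_map_hom X Y p Hp) as Hh.
  destruct (lift_M (pow X) (pow Y) (pow_map p) Hh Z) as (S & HS & HSZ).
  - intros v. destruct (choice (fun i x => p x = v i)) as (u & Hu).
    { intros i; apply Hsurj. }
    exists u. extensionality i. apply Hu.
  - assumption.
  - replace Z with (fun y => exists x, S x /\ pow_map p x = y).
    + apply image_minimal; [assumption|]. now apply HX.
    + extensionality y. apply propositional_extensionality. symmetry; apply HSZ.
Qed.

(** * Pairs of points of a power, and proximal extensions *)

Notation l2 := (list_prod l (true :: false :: nil)).

Lemma in_l2 (ib : I * bool) : In ib l2.
Proof.
  destruct ib as [i b]. apply in_prod; [apply Hl|]. destruct b; simpl; auto.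
Qed.

(** Doubling the index set encodes the square of [pow X]; both copies of a coordinate carry the same
    exponent. *)
Notation pow2 X := (power (I * bool) l2 in_l2 X (fun ib => ex (fst ib))).

Definition side {X : tds} (b : bool) (w : pow2 X) : pow X := fun i => w (i, b).

Lemma side_hom (X : tds) (b : bool) : hom (pow2 X) (pow X) (side b).
Proof.
  split; [|reflexivity]. intros u e he. exists e; split; [assumption|].
  intros v hv. apply pow_dist_lt; [assumption|assumption|]. intros i.
  now apply (pow_dist_lt (I * bool) l2 in_l2).
Qed.

(* Writing a time of closeness as m = q (ex i) + r with r < ex i, the i-th pair
   comes close at time q of the product action up to T^r; one r works for all
   e, so M meets the invariant set where the i-th coordinates agree. *)
Lemma minimal_proximal_diagonal (X Y : tds) (p : X -> Y) (M : pow2 X -> Prop) :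
  (forall i, (0 < ex i)%nat) -> proximal_map X Y p ->
  minimal_set (ball (pow2 X)) (T (pow2 X)) (Tinv (pow2 X)) M ->
  (forall w i, M w -> p (w (i, true)) = p (w (i, false))) ->
  forall w, M w -> side true w = side false w.
Proof.
  intros Hex Hprox ((w0 & Hw0) & HM & Hmin) HMp w Hw.
  extensionality i. unfold side.
  assert (Hc : forall (n : Z) (b : bool),
            cont (pow2 X) X (fun w => Tn X n (w (i, b)))).
  { intros n b. apply (cont_comp (pow2 X) X X (fun w => w (i, b)) (Tn X n)).
    - apply power_coord_cont.
    - intros x e he. now apply Tn_cont. }
  apply (Hmin (fun w => M w /\ w (i, true) = w (i, false)));
    [now intros ? []| | |assumption].
  - destruct (finite_pigeonhole (ex i) (fun r e => exists q : Z,
      rho X (Tn X (Z.of_nat r + q * Z.of_nat (ex i)) (w0 (i, true)))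
            (Tn X (Z.of_nat r + q * Z.of_nat (ex i)) (w0 (i, false))) <= e))
      as (r & hr & Hr).
    + intros r e e' hee (q & Hq). exists q; lra.
    + intros e he.
      destruct (Hprox _ _ (HMp w0 i Hw0) e he O) as (m & _ & hm).
      specialize (Hex i).
      (* Floor division gives a remainder in the range from 0 to [ex i - 1] for negative times as
         well. *)
      pose proof (Z.mod_pos_bound m (Z.of_nat (ex i)) ltac:(lia)).
      exists (Z.to_nat (m mod Z.of_nat (ex i))); split; [lia|].
      exists (m / Z.of_nat (ex i))%Z.
      rewrite Z2Nat.id by lia.
      replace (m mod Z.of_nat (ex i) + m / Z.of_nat (ex i) * Z.of_nat (ex i))%Z
        with m by (rewrite Z.mod_eq by lia; lia).
      lra.
    (* Along the orbit of [w0] the two [i]-th coordinates, shifted by [r], get arbitrarily close.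
       Compactness of [M] yields a point where they agree, and the shift is then undone. *)
    + destruct (closed_attains_zero (pow2 X) M
        (fun w => rho X (Tn X (Z.of_nat r) (w (i, true)))
                        (Tn X (Z.of_nat r) (w (i, false))))) as (w1 & Hw1 & h1).
      * apply HM.
      * intros e. apply closed_dist_le; apply Hc.
      * intros e he. destruct (Hr e he) as (q & Hq).
        exists (Tn (pow2 X) q w0); split; [now apply subsystem_Tn|].
        rewrite !power_Tn. simpl fst. now rewrite <- !Tn_add.
      * exists w1; split; [assumption|]. apply dist_le0_eq in h1.
        apply (f_equal (Tn X (- Z.of_nat r))) in h1. now rewrite !Tn_opp in h1.
  - apply subsystem_inter; [assumption|]. split.
    + apply closed_eq; apply (Hc 0%Z).
    + intros u Hu. simpl. unfold pow_T, pow_Tinv. simpl. now rewrite Hu.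
Qed.

Lemma proximal_step (X Y : tds) (p : X -> Y) :
  (forall i, (0 < ex i)%nat) -> hom X Y p -> proximal_map X Y p ->
  M_implies_minimal (pow Y) -> M_implies_minimal (pow X).
Proof.
  intros Hex Hp Hprox HY Z HZ. pose proof (pow_map_hom X Y p Hp) as Hh.
  pose proof (HY _ (image_M _ _ _ Hh Z HZ)) as Himg.
  destruct HZ as (HZ & (z0 & Hz0 & _) & Hden).
  split; [now exists z0|]. split; [assumption|].
  intros S HSZ [s0 Hs0] HS x Hx.
  apply (closure_least (pow X) (fun z => Z z /\
    minimal_point (ball (pow X)) (T (pow X)) (Tinv (pow X)) z) S);
    [apply HS| |now apply Hden].
  clear x Hx. intros z [Hz Hm].
  pose (K := closure (ball (pow X)) (orbit (T (pow X)) (Tinv (pow X)) z)).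
  assert (HK : subsystem (ball (pow X)) (T (pow X)) (Tinv (pow X)) K)
    by apply orbit_closure_subsystem.
  (* By minimality of the image of [Z], the image of [S] is all of it, which provides a point [s] of
     [S] over the image of [z]. *)
  destruct (proj2 (proj2 Himg) (fun y => exists x, S x /\ pow_map p x = y))
    with (x := pow_map p z) as (s & Hs & Hps).
  { intros y (x & Hx & <-). exists x; auto. }
  { now exists (pow_map p s0), s0. }
  { now apply image_subsystem. }
  { now exists z. }
  (* The fibre product of [K] and [S], nonempty because of the pair of [z] and [s]. *)
  destruct (exists_minimal_set (pow2 X) (fun w =>
    (K (side true w) /\ S (side false w)) /\
    pow_map p (side true w) = pow_map p (side false w))) as (M & HMR & HM).
  - apply subsystem_inter; [apply subsystem_inter|].
    + apply (preimage_subsystem _ _ _ (side_hom X true) K HK).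
    + apply (preimage_subsystem _ _ _ (side_hom X false) S HS).
    + pose proof (fun b => cont_comp _ _ _ _ _ (proj1 (side_hom X b)) (proj1 Hh))
        as Hc.
      split; [exact (closed_eq _ _ _ _ (Hc true) (Hc false))|].
      intros w Hw. rewrite !(proj2 (side_hom X _)), !(hom_Tinv _ _ _ (side_hom X _)),
        !(proj2 Hh), !(hom_Tinv _ _ _ Hh), Hw. auto.
  - exists (fun ib : I * bool => if snd ib then z (fst ib) else s (fst ib)).
    split; [split|].
    + apply orbit_closure_self.
    + exact Hs.
    + symmetry; exact Hps.
  (* A pair in [M] is diagonal, so its common side lies in both [K] and [S]; minimality of [K] then
     puts [z] in [S]. *)
  - destruct (proj1 HM) as (w & Hw).
    destruct (HMR w Hw) as [[HwK HwS] _].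
    rewrite <- (minimal_proximal_diagonal X Y p M Hex Hprox HM) in HwS;
      [|now intros w' i Hw'; destruct (HMR w' Hw') as [_ h]; exact (equal_f h i)
       |assumption].
    apply (proj2 (proj2 Hm) (fun x => K x /\ S x)).
    + now intros ? [].
    + now exists (side true w).
    + now apply subsystem_inter.
    + apply orbit_closure_self.
Qed.

(** * The bottom and limit stages, and transfinite induction along the tower *)

Lemma trivial_step (X : tds) :
  (exists x : X, forall x', x' = x) -> M_implies_minimal (pow X).
Proof.
  intros (x0 & Hx0) Z (HZ & (z & Hz & _) & _).
  split; [now exists z|]. split; [assumption|].
  intros S _ [s Hs] _ x _. replace x with s; [assumption|].
  extensionality i. now rewrite (Hx0 (s i)), (Hx0 (x i)).
Qed.

Lemma limit_step (X : tds) (J : Type) (B : J -> tds) (p : forall j, X -> B j) :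
  inhabited J -> (forall j, hom X (B j) (p j)) ->
  (forall i j, exists k, forall x y, p k x = p k y ->
     p i x = p i y /\ p j x = p j y) ->
  (forall x y, (forall j, p j x = p j y) -> x = y) ->
  (forall j, M_implies_minimal (pow (B j))) -> M_implies_minimal (pow X).
Proof.
  intros HJ Hp Hdir Hsep HB Z HZ.
  pose proof (fun j => pow_map_hom X (B j) (p j) (Hp j)) as Hh.
  apply (separated_limit_minimal (pow X) J (fun j => pow (B j))
           (fun j => pow_map (p j))); auto.
  - intros i j. destruct (Hdir i j) as (k & Hk). exists k. intros u v Huv.
    split; extensionality a; apply (Hk (u a) (v a)); exact (equal_f Huv a).
  - intros u v Huv. extensionality a. apply Hsep. intros j.
    exact (equal_f (Huv j) a).
  - destruct HZ as (_ & (z & Hz & _) & _). now exists z.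
  - apply HZ.
  - intros j. apply HB. now apply image_M.
Qed.

Lemma strictly_PI_M_implies_minimal (X : tds) :
  (forall i, (0 < ex i)%nat) -> strictly_PI X -> M_implies_minimal (pow X).
Proof.
  intros Hex (_ & K & lt & z & eta & (Htrans & Htot & Hwf) & Hz & _ & H).
  simpl in H.
  destruct H as (W & pi & Htriv & <- & Hfac & Hid & Hcomp & Hsucc & Hlim).
  assert (Hhom : forall k i h, hom (W k) (W i) (pi k i h)).
  { intros k i h. destruct (Hfac k i h) as (? & _ & ?). now split. }
  (* The claim is proved for every stage [W k], by well-founded induction; a stage is the least one,
     a successor or a limit. *)
  generalize eta. clear eta. intros k.
  induction (Hwf k) as [k _ IH].
  destruct (classic (exists i, lt i k)) as [(i0 & Hi0)|Hno].
  2:{ destruct (Htot k z) as [->|[h|h]].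
      - now apply trivial_step.
      - now elim (Hz k).
      - elim Hno; now exists z. }
  destruct (classic (exists i, lt i k /\ forall j, lt i j -> k = j \/ lt k j))
    as [(i & Hi & Hnext)|Hnosucc].
  - destruct (Hsucc i k (or_intror Hi)) as [h|h]; [now split| |].
    + exact (proximal_step _ _ _ Hex (Hhom _ _ _) h (IH i Hi)).
    + exact (equicontinuous_step _ _ _ (Hhom _ _ _) h (IH i Hi)).
  - assert (Hl' : forall i, lt i k -> exists j, lt i j /\ lt j k).
    { intros i Hi. apply NNPP; intros Hn. apply Hnosucc.
      exists i; split; [assumption|]. intros j Hj.
      destruct (Htot k j) as [|[|]]; auto. elim Hn; now exists j. }
    assert (Hirr : forall i (h h' : i = k \/ lt i k) x, pi k i h x = pi k i h' x).
    { intros i h h' x.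
      now rewrite <- (Hcomp k k i (or_introl eq_refl) h h'), Hid. }
    apply (limit_step (W k) {i | lt i k} (fun j => W (proj1_sig j))
      (fun j => pi k (proj1_sig j) (or_intror (proj2_sig j)))).
    + constructor. now exists i0.
    + intros j; apply Hhom.
    + assert (Hdown : forall (i j : {i | lt i k}) x y,
        proj1_sig i = proj1_sig j \/ lt (proj1_sig i) (proj1_sig j) ->
        pi k (proj1_sig j) (or_intror (proj2_sig j)) x =
        pi k (proj1_sig j) (or_intror (proj2_sig j)) y ->
        pi k (proj1_sig i) (or_intror (proj2_sig i)) x =
        pi k (proj1_sig i) (or_intror (proj2_sig i)) y).
      { intros i j x y h Hxy.
        rewrite <- (Hcomp k _ _ (or_intror (proj2_sig j)) h) with (x := x).
        rewrite <- (Hcomp k _ _ (or_intror (proj2_sig j)) h) with (x := y).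
        now rewrite Hxy. }
      intros i j. destruct (Htot (proj1_sig i) (proj1_sig j)) as [h|[h|h]].
      * exists j. intros x y Hxy. split; [|assumption].
        apply (Hdown i j); auto.
      * exists j. intros x y Hxy. split; [|assumption].
        apply (Hdown i j); auto.
      * exists i. intros x y Hxy. split; [assumption|].
        apply (Hdown j i); auto.
    + intros x y Hxy.
      (* Separation of points: [x] and [y] both induce the thread of [y], and the inverse limit has
         only one point over a thread. *)
      destruct (Hlim k (ex_intro _ i0 Hi0) Hl'
        (fun i hi => pi k i (or_intror hi) y)) as (x' & _ & Huniq).
      { intros j i hj hi h. apply Hcomp. }
      rewrite (Huniq x), (Huniq y); [reflexivity| |].
      * intros i hi h. apply Hirr.
      * intros i hi h. rewrite (Hirr i h (or_intror hi)).
        exact (Hxy (exist _ i hi)).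
    + intros [i hi]. now apply IH.
Qed.

End PowerMaps.

(** * Transfer to the power indexed by [ordinal d] *)

Lemma in_ord_enum (d : nat) (i : fintype.ordinal d) : In i (fintype.ord_enum d).
Proof.
  pose proof (fintype.mem_ord_enum i) as H. revert H.
  induction (fintype.ord_enum d) as [|a s IH]; [discriminate|].
  rewrite seq.in_cons. intros H. apply Bool.orb_prop in H as [H|H].
  - left. symmetry. exact (ssrbool.elimT eqtype.eqP H).
  - right. now apply IH.
Qed.

Theorem theoremC (X : tds) (d : nat) :
  minimal_tds X -> PI_system X -> (2 <= d)%nat ->
  forall Z : Xpow X d -> Prop, M_subsystem X d Z -> minimal_subsystem X d Z.
Proof.
  intros _ (_ & Xt & p & HXt & (Hc & Hsurj & Hp) & _) _ Z HZ.
  pose (l := fintype.ord_enum d). pose (Hl := @in_ord_enum d).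
  (* With these exponents [pow_T] is [tau] by conversion, and all exponents are positive, as the
     proximal step requires. *)
  pose (ex := fun i : fintype.ordinal d => S (fintype.nat_of_ord i)).
  pose (A := power _ l Hl X ex).
  (* At positive radius the balls of [pow_dist] are those of [pball], so the closures agree; the
     dynamical notions see the topology only through closures. *)
  assert (Hcl : closure (pball X d) = closure (ball A)).
  { extensionality S. extensionality u. apply propositional_extensionality.
    split; intros H e he; destruct (H e he) as (v & Hv & h); exists v;
      (split; [assumption|]).
    - exact (proj2 (pow_dist_lt _ l Hl X u v e he) h).
    - exact (proj1 (pow_dist_lt _ l Hl X u v e he) h). }
  assert (HA : M_implies_minimal A).
  { apply (factor_step _ l Hl ex Xt X p); [now split|assumption|].
    apply strictly_PI_M_implies_minimal; [|assumption].
    intros i; unfold ex; lia. }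
  specialize (HA Z).
  unfold M_subsystem, minimal_subsystem, M_set, minimal_set, minimal_point,
    transitive_set, minimal_set, subsystem, closedS in *.
  rewrite Hcl in *. now apply HA.
Qed.
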